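(* Let $\Sigma=\{\sigma\}$ be a one-letter alphabet. There is an algorithm which, given a $k_1$-letter QFA $\mathcal{A}_1$ with $n_1$ states and a $k_2$-letter QFA $\mathcal{A}_2$ with $n_2$ states over $\Sigma$ ($k_1,k_2\geq 1$), all of whose data (entries of the initial vectors and of the transition matrices) are complex numbers with rational real and imaginary parts, decides whether $\mathcal{A}_1$ and $\mathcal{A}_2$ are equivalent, in time $O(n^{12}+k^2n^4+kn^8)$, where $n=n_1+n_2$, $k=\max(k_1,k_2)$, and each arithmetic operation on rational numbers is counted as taking constant time.
   Context: Let $k\geq 1$. A $k$-letter quantum finite automaton ($k$-letter QFA) is a quintuple $\mathcal{A}=(Q,Q_{acc},|\psi_0\rangle,\Sigma,\mu)$, where $Q$ is a finite set of states, identified with an orthonormal basis of $\mathbb{C}^{|Q|}$; $Q_{acc}\subseteq Q$ is the set of accepting states; $|\psi_0\rangle\in\mathbb{C}^{|Q|}$ is a unit vector (initial state); $\Sigma$ is a finite input alphabet; and $\mu$ assigns to each string $w\in(\{\Lambda\}\cup\Sigma)^k$ a unitary matrix $\mu(w)$ on $\mathbb{C}^{|Q|}$, where $\Lambda\notin\Sigma$ is a blank symbol. For $x=\sigma_1\cdots\sigma_m\in\Sigma^*$, put $\sigma_j=\Lambda$ for $j\leq 0$ and define $\overline{\mu}(x)=\prod_{i=1}^m\mu(\sigma_{i-k+1}\sigma_{i-k+2}\cdots\sigma_i)$, the factors being ordered from left to right by increasing $i$ (and $\overline{\mu}$ of the empty string is the identity). Let $P_{acc}$ be the orthogonal projector onto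 the span of $Q_{acc}$. The accepting probability of $x$ is $P_{\mathcal{A}}(x)=\|\langle\psi_0|\overline{\mu}(x)P_{acc}\|^2$. Two multi-letter QFAs $\mathcal{A}_1,\mathcal{A}_2$ over the same input alphabet $\Sigma$ are equivalent if $P_{\mathcal{A}_1}(w)=P_{\mathcal{A}_2}(w)$ for all $w\in\Sigma^*$. *)

(* Defs.v *)
(* The real numbers are an arbitrary R : realType and the complex numbers are
   R[i]. *)
From mathcomp Require Import all_boot all_order all_algebra.
From mathcomp Require Import complex.
From mathcomp Require Import boolp reals.

Set Implicit Arguments.
Unset Strict Implicit.
Unset Printing Implicit Defensive.

Import Order.TTheory GRing.Theory Num.Theory.
Local Open Scope ring_scope.
Local Open Scope complex_scope.
Local Open Scope sesquilinear_scope.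

(* Squared Euclidean norm; [Normc.normc] is the real-valued modulus. *)
Definition sqnorm (R : realType) (n : nat) (v : 'rV[R[i]]_n) : R :=
  \sum_(j < n) Normc.normc (v 0 j) ^+ 2.

(* A k-letter QFA with the n states 0, ..., n.-1, identified with the standard
   basis of C^n. The blank symbol is [None : option Sigma]; [psi0] is the
   column vector |psi_0>, so its conjugate transpose is <psi_0|. *)
Record qfa (R : realType) (Sigma : finType) (k n : nat) := QFA {
  acc : {set 'I_n};
  psi0 : 'cV[R[i]]_n;
  mu : k.-tuple (option Sigma) -> 'M[R[i]]_n;
  psi0_unit : sqnorm (psi0 ^t*) = 1;
  mu_unitary : forall w, mu w \is unitarymx
}.

(* sigma_j for j an integer: the letters of x are numbered from 1, and sigma_j
   is blank for j <= 0. (The blanks beyond the end of x are never used.) *)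
Definition letter (Sigma : finType) (x : seq Sigma) (j : int) : option Sigma :=
  if j is Posz j'.+1 then nth None (map Some x) j' else None.

Definition window (Sigma : finType) (k : nat) (x : seq Sigma) (i : nat) :
    k.-tuple (option Sigma) :=
  [tuple letter x (i%:Z - k%:Z + 1 + j%:Z) | j < k].

Definition mubar (R : realType) (Sigma : finType) (k n : nat)
    (A : qfa R Sigma k n) (x : seq Sigma) : 'M[R[i]]_n :=
  \prod_(1 <= i < (size x).+1) mu A (window k x i).

Definition Pacc (R : realType) (Sigma : finType) (k n : nat)
    (A : qfa R Sigma k n) : 'M[R[i]]_n :=
  \sum_(q in acc A) delta_mx q q.

Definition accprob (R : realType) (Sigma : finType) (k n : nat)
    (A : qfa R Sigma k n) (x : seq Sigma) : R :=
  sqnorm ((psi0 A) ^t* *m mubar A x *m Pacc A).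

Definition equivalent (R : realType) (Sigma : finType) (k1 n1 k2 n2 : nat)
    (A1 : qfa R Sigma k1 n1) (A2 : qfa R Sigma k2 n2) : Prop :=
  forall w : seq Sigma, accprob A1 w = accprob A2 w.

Definition cplx_of_rat (R : realType) (p q : rat) : R[i] :=
  ratr p +i* ratr q.

Definition rational_data (R : realType) (Sigma : finType) (k n : nat)
    (A : qfa R Sigma k n) : Prop :=
  (forall i, exists p q : rat, psi0 A i 0 = cplx_of_rat R p q) /\
  (forall w i j, exists p q : rat, mu A w i j = cplx_of_rat R p q).

(* The model of computation is a random access machine with a structured
   program. There are finitely many natural number variables, used for counters
   and addresses, and finitely many unbounded arrays of rational numbers, with
   indirect addressing. (A rational variable is a cell of an array.) There is
   no conversion between rationals and naturals. *)
Record state := State {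
  ivar : nat -> nat;
  qmem : nat -> nat -> rat  (* [qmem s a i] is the cell of index i of array a *)
}.

Inductive iexp :=
  | IConst of nat
  | IVar of nat
  | IAdd of iexp & iexp
  | ISub of iexp & iexp
  | IMul of iexp & iexp.

Inductive qexp :=
  | QConst of rat
  | QRead of nat & iexp
  | QAdd of qexp & qexp
  | QSub of qexp & qexp
  | QMul of qexp & qexp
  | QDiv of qexp & qexp.

Inductive bexp :=
  | ILe of iexp & iexp
  | QLe of qexp & qexp
  | BNot of bexp
  | BAnd of bexp & bexp.

Inductive cmd :=
  | Skip
  | ISet of nat & iexp
  | QSet of nat & iexp & qexp
  | Seq of cmd & cmd
  | If of bexp & cmd & cmd
  | While of bexp & cmd.

(* Subtraction of naturals is truncated, and division of rationals by 0
   gives 0. *)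
Fixpoint ieval (s : state) (e : iexp) : nat :=
  match e with
  | IConst m => m
  | IVar x => ivar s x
  | IAdd e1 e2 => (ieval s e1 + ieval s e2)%N
  | ISub e1 e2 => (ieval s e1 - ieval s e2)%N
  | IMul e1 e2 => (ieval s e1 * ieval s e2)%N
  end.

Fixpoint qeval (s : state) (e : qexp) : rat :=
  match e with
  | QConst q => q
  | QRead a i => qmem s a (ieval s i)
  | QAdd e1 e2 => qeval s e1 + qeval s e2
  | QSub e1 e2 => qeval s e1 - qeval s e2
  | QMul e1 e2 => qeval s e1 * qeval s e2
  | QDiv e1 e2 => qeval s e1 / qeval s e2
  end.

Fixpoint beval (s : state) (b : bexp) : bool :=
  match b with
  | ILe e1 e2 => (ieval s e1 <= ieval s e2)%N
  | QLe e1 e2 => qeval s e1 <= qeval s e2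
  | BNot b1 => ~~ beval s b1
  | BAnd b1 b2 => beval s b1 && beval s b2
  end.

(* Every constant, variable or memory access, arithmetic operation, comparison
   and connective costs one unit. *)
Fixpoint icost (e : iexp) : nat :=
  match e with
  | IConst _ | IVar _ => 1
  | IAdd e1 e2 | ISub e1 e2 | IMul e1 e2 => (icost e1 + icost e2).+1
  end.

Fixpoint qcost (e : qexp) : nat :=
  match e with
  | QConst _ => 1
  | QRead _ i => (icost i).+1
  | QAdd e1 e2 | QSub e1 e2 | QMul e1 e2 | QDiv e1 e2 =>
      (qcost e1 + qcost e2).+1
  end.

Fixpoint bcost (b : bexp) : nat :=
  match b with
  | ILe e1 e2 => (icost e1 + icost e2).+1
  | QLe e1 e2 => (qcost e1 + qcost e2).+1
  | BNot b1 => (bcost b1).+1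
  | BAnd b1 b2 => (bcost b1 + bcost b2).+1
  end.

Definition iset (s : state) (x m : nat) : state :=
  State (fun y => if y == x then m else ivar s y) (qmem s).

Definition qset (s : state) (a i : nat) (q : rat) : state :=
  State (ivar s)
    (fun b j => if (b == a) && (j == i) then q else qmem s b j).

(* [exec c s t s']: started in s, the command c halts in s' after t units of
   time. *)
Inductive exec : cmd -> state -> nat -> state -> Prop :=
  | ExecSkip s : exec Skip s 1 s
  | ExecISet s x e : exec (ISet x e) s (icost e).+1 (iset s x (ieval s e))
  | ExecQSet s a i e :
      exec (QSet a i e) s (icost i + qcost e).+1
        (qset s a (ieval s i) (qeval s e))
  | ExecSeq c1 c2 s t1 s1 t2 s2 :
      exec c1 s t1 s1 -> exec c2 s1 t2 s2 ->
      exec (Seq c1 c2) s (t1 + t2).+1 s2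
  | ExecIfTrue b c1 c2 s t s' :
      beval s b -> exec c1 s t s' -> exec (If b c1 c2) s (bcost b + t).+1 s'
  | ExecIfFalse b c1 c2 s t s' :
      ~~ beval s b -> exec c2 s t s' -> exec (If b c1 c2) s (bcost b + t).+1 s'
  | ExecWhileFalse b c s :
      ~~ beval s b -> exec (While b c) s (bcost b).+1 s
  | ExecWhileTrue b c s t1 s1 t2 s2 :
      beval s b -> exec c s t1 s1 -> exec (While b c) s1 t2 s2 ->
      exec (While b c) s (bcost b + t1 + t2).+1 s2.

Lemma exec_deterministic c s t1 s1 t2 s2 :
  exec c s t1 s1 -> exec c s t2 s2 -> t1 = t2 /\ s1 = s2.
Proof.
move=> E; elim: E t2 s2 => {c s t1 s1}.
- by move=> s t2 s2 E; inversion E.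
- by move=> s x e t2 s2 E; inversion E.
- by move=> s a i e t2 s2 E; inversion E.
- move=> c1 c2 s t1 s1 t2 s2 _ IH1 _ IH2 t' s' E; inversion E; subst.
  have [? ?] := IH1 _ _ ltac:(eassumption); subst.
  by have [-> ->] := IH2 _ _ ltac:(eassumption).
- move=> b c1 c2 s t s' bT _ IH t' s'' E; inversion E; subst.
    by have [-> ->] := IH _ _ ltac:(eassumption).
  by match goal with H : is_true (~~ _) |- _ => case/negP: H end.
- move=> b c1 c2 s t s' /negP bF _ IH t' s'' E; inversion E; subst => //.
  by have [-> ->] := IH _ _ ltac:(eassumption).
- by move=> b c s /negP bF t' s' E; inversion E; subst.
move=> b c s t1 s1 t2 s2 bT _ IH1 _ IH2 t' s' E; inversion E; subst.
  by match goal with H : is_true (~~ _) |- _ => case/negP: H end.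
have [? ?] := IH1 _ _ ltac:(eassumption); subst.
by have [-> ->] := IH2 _ _ ltac:(eassumption).
Qed.

(* The position of a word in the lexicographic order of ({Lambda} u Sigma)^k,
   for Sigma = {sigma} and Lambda < sigma: its value as a binary number with
   digits Lambda = 0 and sigma = 1. *)
Definition wcode (w : seq (option unit)) : nat :=
  foldl (fun c a => c.*2 + (a != None))%N 0%N w.

(* The matrices mu(w) are stored one after the other, row by row. *)
Definition mu_addr (k n : nat) (w : k.-tuple (option unit)) (i j : 'I_n) : nat :=
  ((wcode w * n + i) * n + j)%N.

(* The data of A are stored as automaton number d of the input: k and n in
   variables 2d and 2d+1, and the rest in arrays 5d to 5d+4: the indicator
   function of the accepting states, then the real and imaginary parts of
   psi0, then those of mu. *)
Definition stores (s : state) (d : nat) (R : realType) (k n : nat)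
    (A : qfa R unit k n) : Prop :=
  [/\ ivar s (2 * d)%N = k,
      ivar s (2 * d + 1)%N = n,
      forall q : 'I_n, qmem s (5 * d)%N q = (q \in acc A)%:R,
      forall q : 'I_n,
        psi0 A q 0 =
          cplx_of_rat R (qmem s (5 * d + 1)%N q) (qmem s (5 * d + 2)%N q) &
      forall w (i j : 'I_n),
        mu A w i j =
          cplx_of_rat R (qmem s (5 * d + 3)%N (mu_addr w i j))
                        (qmem s (5 * d + 4)%N (mu_addr w i j))].

(* An input state for (A1, A2); everything not mentioned is arbitrary. *)
Definition input_state (s : state) (R : realType) (k1 n1 k2 n2 : nat)
    (A1 : qfa R unit k1 n1) (A2 : qfa R unit k2 n2) : Prop :=
  stores s 0 A1 /\ stores s 1 A2.

(* The answer of a halted program is yes if variable 0 is nonzero, else no. *)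
Definition answers_yes (s : state) : Prop := ivar s 0 != 0%N.

Lemma wcode_inj k : injective (fun w : k.-tuple (option unit) => wcode w).
Proof.
move=> w w' e; apply: val_inj => /=.
move: e; have: size w = size w' by rewrite !size_tuple.
move: (tval w) (tval w') => {w w'}; elim/last_ind => [|x a IH] y.
  by case: y.
elim/last_ind: y => [|y b _]; rewrite ?size_rcons // => -[sz].
rewrite /wcode -!cats1 !foldl_cat /= => e.
have eab : (a != None) = (b != None).
  by have := congr1 odd e; rewrite !oddD !odd_double /= !oddb.
have -> : x = y.
  apply: IH => //; move: e; rewrite eab => /addIn.
  exact: double_inj.
by move: a b eab {e} => [[]|] [[]|].
Qed.

Lemma mu_addr_inj k n w w' (i i' j j' : 'I_n) :
  mu_addr (k := k) w i j = mu_addr w' i' j' -> (w, i, j) = (w', i', j').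
Proof.
have divmod (a a' : nat) (b b' : 'I_n) :
    (a * n + b = a' * n + b')%N -> a = a' /\ b = b'.
  move=> e; have n0 : (0 < n)%N by exact: leq_ltn_trans (leq0n b) (ltn_ord b).
  have ea : a = a'.
    have := congr1 (divn^~ n) e.
    by rewrite !divnMDl // !divn_small ?addn0.
  split=> //; apply: val_inj => /=.
  by move: e; rewrite ea => /addnI.
by rewrite /mu_addr => /divmod [/divmod [/wcode_inj -> ->] ->].
Qed.

Lemma input_state_exists (R : realType) (k1 n1 k2 n2 : nat)
    (A1 : qfa R unit k1 n1) (A2 : qfa R unit k2 n2) :
  rational_data A1 -> rational_data A2 -> exists s, input_state s A1 A2.
Proof.
have H k n (A : qfa R unit k n) : rational_data A ->
    exists m : nat -> nat -> rat,
    [/\ forall q : 'I_n, m 0%N q = (q \in acc A)%:R,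
        forall q : 'I_n, psi0 A q 0 = cplx_of_rat R (m 1%N q) (m 2%N q) &
        forall w (i j : 'I_n), mu A w i j =
          cplx_of_rat R (m 3%N (mu_addr w i j)) (m 4%N (mu_addr w i j))].
  case=> hpsi hmu.
  have /choice[f fP] (q : 'I_n) :
      exists r : rat * rat, psi0 A q 0 = cplx_of_rat R r.1 r.2.
    by have [a [b ->]] := hpsi q; exists (a, b).
  have /choice[g gP] (p : k.-tuple (option unit) * 'I_n * 'I_n) :
      exists r : rat * rat, mu A p.1.1 p.1.2 p.2 = cplx_of_rat R r.1 r.2.
    by have [a [b ->]] := hmu p.1.1 p.1.2 p.2; exists (a, b).
  pose F x : rat * rat := if insub x is Some q then f q else 0.
  pose G x : rat * rat :=
    if [pick p : k.-tuple (option unit) * 'I_n * 'I_n |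
        mu_addr p.1.1 p.1.2 p.2 == x] is Some p then g p else 0.
  pose I x : rat := if insub x is Some q then (q \in acc A)%:R else 0.
  exists (fun a x => nth 0 [:: I x; (F x).1; (F x).2; (G x).1; (G x).2] a).
  have FE (q : 'I_n) : F q = f q by rewrite /F valK.
  split=> [q|q|w i j] /=.
  - by rewrite /I valK.
  - by rewrite FE fP.
  - rewrite /G; case: pickP => [p /eqP e|/(_ (w, i, j))]; last by rewrite eqxx.
    have -> : p = (w, i, j) by rewrite -(mu_addr_inj e); case: p {e} => [[]].
    by rewrite -gP.
move=> /H[m1 [a1 b1 c1]] /H[m2 [a2 b2 c2]].
exists (State (fun x => nth 0%N [:: k1; n1; k2; n2] x)
              (fun a => if (a < 5)%N then m1 a else m2 (a - 5)%N)).
by split; split.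
Qed.

(* Main.v *)
(* Over a one-letter alphabet the row vector v_m = <psi_0| mubar(sigma^m) obeys
   v_{m+1} = v_m mu(Lambda^{k-m-1} sigma^{m+1}) for m < k and v_{m+1} = v_m U,
   with U = mu(sigma^k), afterwards. The accepting probability is linear in
   v_m^* v_m, so from m = k1 + k2 on the difference of the two probabilities is
   a linear functional of a linear orbit in a space of dimension (n1 + n2)^2.
   By Cayley-Hamilton it vanishes identically as soon as it vanishes
   (n1 + n2)^2 times in a row. Hence it suffices to compare the first
   k1 + k2 + (n1 + n2)^2 probabilities, and computing v_{m+1} from v_m costs
   O(n^2). *)
Require Import Defs.
From mathcomp Require Import all_boot all_order all_algebra.
From mathcomp Require Import complex.
From mathcomp Require Import boolp reals.
From mathcomp Require Import zify ring.

Set Implicit Arguments.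
Unset Strict Implicit.
Unset Printing Implicit Defensive.

Import Order.TTheory GRing.Theory Num.Theory.
Local Open Scope ring_scope.
Local Open Scope complex_scope.
Local Open Scope sesquilinear_scope.

(** * Linear functionals along linear orbits *)

(** Reducing ['X^i] modulo [char_poly A] writes [A ^+ i] as a linear combination of the powers below
    [N], by Cayley-Hamilton. *)
Lemma krylov_eq0 (F : fieldType) (N : nat) (A : 'M[F]_N) (u : 'rV_N)
    (c : 'cV_N) :
  (forall i, (i < N)%N -> u *m A ^+ i *m c = 0) ->
  forall i, u *m A ^+ i *m c = 0.
Proof.
case: N A u c => [|N] A u c h i; first by rewrite [u]thinmx0 !mul0mx.
have -> : A ^+ i = horner_mx A ('X^i %% char_poly A).
  have -> : A ^+ i = horner_mx A 'X^i by rewrite rmorphXn /= horner_mx_X.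
  rewrite {1}(divp_eq 'X^i (char_poly A)).
  by rewrite rmorphD rmorphM /= Cayley_Hamilton mulr0 add0r.
set p := _ %% _.
have szp : (size p <= N.+1)%N.
  rewrite -ltnS -(size_char_poly A) ltn_modp.
  by rewrite monic_neq0 // char_poly_monic.
rewrite -[p]coefK poly_def rmorph_sum mulmx_sumr mulmx_suml big1 // => j _.
rewrite /= horner_mxZ rmorphXn /= horner_mx_X -scalemxAr -scalemxAl h.
  by rewrite scaler0.
exact: leq_trans (ltn_ord j) szp.
Qed.

(* The bilinear form u D v^T is linear in the rank one matrix u^T v, which
   evolves in a space of dimension [n * n]. *)
Lemma bilinear_orbit_eq0 (F : fieldType) (n : nat) (B D U : 'M[F]_n)
    (u v : nat -> 'rV[F]_n) :
  (forall m, u m.+1 = u m *m B) -> (forall m, v m.+1 = v m *m U) ->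
  (forall m, (m < n * n)%N -> u m *m D *m (v m)^T = 0) ->
  forall m, u m *m D *m (v m)^T = 0.
Proof.
move=> hu hv h m.
(* [A] is the matrix of [X |-> B^T X U] on vectorised matrices; the functional applied to the orbit
   is [(mxvec D)^T]. *)
pose A := lin_mulmx B^T *m lin_mulmxr U.
have wE i : mxvec ((u i)^T *m v i) = mxvec ((u 0%N)^T *m v 0%N) *m A ^+ i.
  elim: i => [|i IH]; first by rewrite expr0 mulmx1.
  rewrite exprSr mulmxA -IH /A mulmxA !mul_vec_lin /= hu hv trmx_mul.
  by rewrite !mulmxA.
rewrite -mxvec_dotmul wE; apply: krylov_eq0 => i ilt.
by rewrite -wE mxvec_dotmul h.
Qed.

(** * Runs of a QFA on unary words *)

Lemma word_nseq (w : seq unit) : w = nseq (size w) tt.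
Proof. by elim: w => //= -[] w {1}->. Qed.

Section UnaryRun.

Variable R : realType.

Lemma sqr_normcE (z : R[i]) : ((Normc.normc z) ^+ 2)%:C = z^* * z.
Proof.
case: z => a b /=; rewrite sqr_sqrtr ?addr_ge0 ?sqr_ge0 //.
by apply/eqP; rewrite eq_complex /=; apply/andP; split; apply/eqP; ring.
Qed.

Section OneAutomaton.

Variables (k n : nat) (A : qfa R unit k n).

Lemma tval_window m i : (i <= m)%N ->
  window k (nseq m tt) i =
    nseq (k - minn i k) None ++ nseq (minn i k) (Some tt) :> seq _.
Proof.
move=> im; apply: (@eq_from_nth _ None).
  by rewrite size_tuple size_cat !size_nseq; lia.
rewrite size_tuple => j jk.
rewrite -[j]/(val (Ordinal jk)) -tnth_nth tnth_mktuple /= nth_cat !size_nseq.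
(* Entry [j] of the window is the letter numbered [i - k + 1 + j]; this number is positive exactly
   when [k <= i + j], and otherwise the entry is blank. *)
rewrite !nth_nseq; have [kij|kij] := leqP k (i + j).
  have -> : (i%:Z - k%:Z + 1 + j%:Z) = Posz (i + j - k).+1 by lia.
  rewrite /letter map_nseq nth_nseq.
  rewrite ifT; last lia.
  by rewrite ifF ?ifT //; lia.
have h : ~ exists j', (i%:Z - k%:Z + 1 + j%:Z) = Posz (j'.+1).
  by case=> j'; lia.
rewrite ifT; last lia.
rewrite ifT; last lia.
by case: (_ + _) h => [[|j']|] // []; exists j'.
Qed.

(** The window at position [i] sees no later letter, so the shortest word reaching [i] represents
    all longer ones. *)
Definition uwin i := window k (nseq i tt) i.

Lemma window_uwin m i : (i <= m)%N -> window k (nseq m tt) i = uwin i.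
Proof. by move=> im; apply: val_inj; rewrite /= !tval_window. Qed.

Lemma uwin_const i : (k <= i)%N -> uwin i = uwin k.
Proof.
by move=> ki; apply: val_inj; rewrite /= !tval_window // minnn (minn_idPr ki).
Qed.

(** The leading blanks contribute nothing, and the [minn i k] letters are binary digits 1. *)
Lemma wcode_uwin i : wcode (uwin i) = (2 ^ minn i k).-1.
Proof.
rewrite tval_window // /wcode foldl_cat.
have -> r : foldl (fun c a => c.*2 + (a != None :> option unit))%N 0%N
    (nseq r None) = 0%N by elim: r.
(* Each letter sends [c] to [2c + 1], that is, doubles [c + 1]. *)
have h r c : foldl (fun c a => c.*2 + (a != None :> option unit))%N c
    (nseq r (Some tt)) = ((c.+1) * 2 ^ r).-1.
  elim: r c => [|r IH] c; first by rewrite muln1.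
  rewrite /= IH expnS; congr _.-1; rewrite mulnA; congr (_ * _)%N.
  by rewrite addn1 -muln2; lia.
by rewrite h mul1n.
Qed.

Definition urow m : 'rV[R[i]]_n := (psi0 A) ^t* *m mubar A (nseq m tt).

Lemma urow0 : urow 0 = (psi0 A) ^t*.
Proof. by rewrite /urow /mubar big_geq //= mulmx1. Qed.

(** An appended letter changes none of the earlier windows, so it only adds one factor on the
    right. *)
Lemma urowS m : urow m.+1 = urow m *m mu A (uwin m.+1).
Proof.
rewrite /urow /mubar !size_nseq big_nat_recr // mulmxA.
rewrite (eq_big_nat _ _ (F2 := fun i => mu A (window k (nseq m tt) i))) //.
by move=> i /andP[_ im]; rewrite !window_uwin // ltnW.
Qed.

Lemma mulmx_Pacc (v : 'rV[R[i]]_n) j :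
  (v *m Pacc A) 0 j = if j \in acc A then v 0 j else 0.
Proof.
rewrite /Pacc mulmx_sumr summxE.
under eq_bigr => q _.
  rewrite mxE (bigD1 q) //= mxE eqxx andTb big1 => [|l lq]; last first.
    by rewrite mxE (negPf lq) mulr0.
  rewrite addr0; over.
case: ifP => [ja|/negP ja].
  rewrite (bigD1 j) //= eqxx mulr1 big1 ?addr0 // => q /andP[_ qj].
  by rewrite eq_sym (negPf qj) mulr0.
rewrite big1 // => q qa; have /negPf -> : j != q; last by rewrite mulr0.
by apply: contra_notN ja => /eqP ->.
Qed.

Lemma accprob_nseq m :
  accprob A (nseq m tt) =
  \sum_(j < n) (j \in acc A)%:R * Normc.normc (urow m 0 j) ^+ 2.
Proof.
rewrite /accprob /sqnorm; apply: eq_bigr => j _.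
rewrite mulmx_Pacc; case: ifP => _; rewrite ?mul1r // mul0r.
by rewrite Normc.normc0 expr0n.
Qed.

(** Taking the conjugate row as a second orbit gives the probability the shape that
    [bilinear_orbit_eq0] requires. *)
Lemma accprob_bilinear m :
  (accprob A (nseq m tt))%:C%:M =
  map_mx conjc (urow m) *m Pacc A *m (urow m)^T :> 'M_1.
Proof.
apply/matrixP => i j; rewrite !ord1 accprob_nseq !mxE /= mulr1n.
rewrite (rmorph_sum (real_complex R)) /=.
apply: eq_bigr => q _; rewrite mulmx_Pacc !mxE rmorphM /= sqr_normcE.
by case: ifP => _ ; rewrite ?rmorph1 ?mul1r // rmorph0 !mul0r.
Qed.

End OneAutomaton.

(** On the direct sum of the automata, with [- Pacc A2] as second block, the difference of the
    probabilities is a single bilinear form. From length [k1 + k2] on both windows are full, so the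
    transition matrix is constant. *)
Lemma equivalent_bounded (k1 n1 k2 n2 : nat)
    (A1 : qfa R unit k1 n1) (A2 : qfa R unit k2 n2) :
  (forall m, (m < k1 + k2 + (n1 + n2) * (n1 + n2))%N ->
    accprob A1 (nseq m tt) = accprob A2 (nseq m tt)) ->
  equivalent A1 A2.
Proof.
move=> h w; rewrite (word_nseq w); move: (size w) => m {w}.
have [/h//|] := ltnP m (k1 + k2 + (n1 + n2) * (n1 + n2)).
set m0 := (k1 + k2)%N => mge.
pose v i := row_mx (urow A1 (m0 + i)) (urow A2 (m0 + i)).
pose U : 'M_(n1 + n2) := block_mx (mu A1 (uwin k1 k1)) 0 0 (mu A2 (uwin k2 k2)).
pose D : 'M_(n1 + n2) := block_mx (Pacc A1) 0 0 (- Pacc A2).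
pose u i := map_mx conjc (v i).
have vS i : v i.+1 = v i *m U.
  rewrite /v addnS !urowS !uwin_const ?/m0; try lia.
  by rewrite mul_row_block !mulmx0 addr0 add0r.
(* The conjugate row evolves under the conjugate matrix, which is the matrix [B] of
   [bilinear_orbit_eq0]. *)
have uS i : u i.+1 = u i *m map_mx conjc U by rewrite /u vS; exact: map_mxM.
have E i : u i *m D *m (v i)^T =
    (accprob A1 (nseq (m0 + i) tt) - accprob A2 (nseq (m0 + i) tt))%:C%:M.
  rewrite /u /v map_row_mx mul_row_block tr_row_mx mul_row_col.
  rewrite !mulmx0 addr0 add0r mulmxN mulNmx -!accprob_bilinear.
  by rewrite rmorphB raddfB.
have /matrixP/(_ 0 0) : u (m - m0)%N *m D *m (v (m - m0)%N)^T = 0.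
  apply: (bilinear_orbit_eq0 uS vS) => i ilt.
  by rewrite E h ?ltn_add2l // subrr rmorph0.
have m0m : (m0 + (m - m0) = m)%N by rewrite subnKC //; lia.
rewrite E m0m !mxE mulr1n => e.
by apply/eqP; rewrite -subr_eq0; apply/eqP/complexI; rewrite rmorph0.
Qed.

End UnaryRun.

(** * A program logic with time bounds *)

Fixpoint writes_i (c : cmd) (x : nat) : bool :=
  match c with
  | Skip | QSet _ _ _ => false
  | ISet y _ => x == y
  | Seq c1 c2 | If _ c1 c2 => writes_i c1 x || writes_i c2 x
  | While _ c1 => writes_i c1 x
  end.

Fixpoint writes_q (c : cmd) (a : nat) : bool :=
  match c with
  | Skip | ISet _ _ => false
  | QSet b _ _ => a == b
  | Seq c1 c2 | If _ c1 c2 => writes_q c1 a || writes_q c2 a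
  | While _ c1 => writes_q c1 a
  end.

(** The frame condition. The possible writes are read off the syntax, so its side conditions are
    decided by computation. *)
Definition agree (c : cmd) (s s' : state) : Prop :=
  (forall x, ~~ writes_i c x -> ivar s' x = ivar s x) /\
  (forall a, ~~ writes_q c a -> qmem s' a =1 qmem s a).

Lemma exec_agree c s t s' : exec c s t s' -> agree c s s'.
Proof.
elim=> {c s t s'} //=.
- by move=> s x e; split=> // y /= /negPf ->.
- by move=> s a i e; split=> // b /= /negPf h j /=; rewrite h.
- move=> c1 c2 s t1 s1 t2 s2 _ [h1 g1] _ [h2 g2]; split=> /= x /norP[n1 n2].
    by rewrite h2 ?h1.
  by move=> j; rewrite g2 ?g1.
- by move=> b c1 c2 s t s' _ _ [h g]; split=> /= x /norP[]; [move/h|move/g].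
- by move=> b c1 c2 s t s' _ _ [h g]; split=> /= x /norP[_]; [move/h|move/g].
- move=> b c s t1 s1 t2 s2 _ _ [h1 g1] _ [h2 g2]; split=> /= x nx.
    by rewrite h2 ?h1.
  by move=> j; rewrite g2 ?g1.
Qed.

(** A total-correctness triple with time budget [T]. The postcondition may itself be a [runs], which
    gives the sequencing rule its nested form. *)
Definition runs (c : cmd) (s : state) (T : nat) (Q : state -> Prop) : Prop :=
  exists t s', [/\ exec c s t s', (t <= T)%N & Q s'].

(** The consequence rule supplies the frame condition, so postconditions need not list what is
    unchanged. *)
Lemma runs_weaken c s T T' (Q Q' : state -> Prop) :
  (T <= T')%N -> (forall s', agree c s s' -> Q s' -> Q' s') ->
  runs c s T Q -> runs c s T' Q'.
Proof.
move=> TT h [t [s' [e tT q]]]; exists t, s'; split=> //.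
  exact: leq_trans TT.
by apply: h => //; apply: exec_agree e.
Qed.

Lemma runs_iset x e s (Q : state -> Prop) :
  Q (iset s x (ieval s e)) -> runs (ISet x e) s (icost e).+1 Q.
Proof. by move=> q; do 2 eexists; split; [exact: ExecISet| |]. Qed.

Lemma runs_qset a i e s (Q : state -> Prop) :
  Q (qset s a (ieval s i) (qeval s e)) ->
  runs (QSet a i e) s (icost i + qcost e).+1 Q.
Proof. by move=> q; do 2 eexists; split; [exact: ExecQSet| |]. Qed.

Lemma runs_seq c1 c2 s T1 T2 (Q : state -> Prop) :
  runs c1 s T1 (fun s1 => runs c2 s1 T2 Q) ->
  runs (Seq c1 c2) s (T1 + T2).+1 Q.
Proof.
case=> t1 [s1 [e1 l1 [t2 [s2 [e2 l2 q]]]]].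
exists (t1 + t2).+1, s2; split=> //; first exact: ExecSeq e1 e2.
by rewrite ltnS leq_add.
Qed.

Lemma runs_if b c1 c2 s T (Q : state -> Prop) :
  (beval s b -> runs c1 s T Q) -> (~~ beval s b -> runs c2 s T Q) ->
  runs (If b c1 c2) s (bcost b + T).+1 Q.
Proof.
move=> h1 h2; have [bT|bF] := boolP (beval s b).
  have [t [s' [e l q]]] := h1 bT; exists (bcost b + t).+1, s'; split=> //.
    exact: ExecIfTrue.
  by rewrite ltnS leq_add2l.
have [t [s' [e l q]]] := h2 bF; exists (bcost b + t).+1, s'; split=> //.
  exact: ExecIfFalse.
by rewrite ltnS leq_add2l.
Qed.

Lemma runs_skip s (Q : state -> Prop) : Q s -> runs Skip s 1 Q.
Proof. by move=> q; do 2 eexists; split; [exact: ExecSkip| |]. Qed.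

(** The test [x < y] becomes [x + 1 <= y] because only a non-strict comparison is available. *)
Definition For (x y : nat) (c : cmd) : cmd :=
  Seq (ISet x (IConst 0))
    (While (ILe (IAdd (IVar x) (IConst 1)) (IVar y))
       (Seq c (ISet x (IAdd (IVar x) (IConst 1))))).

Lemma runs_for x y c s B (I : nat -> state -> Prop) :
  x != y -> ~~ writes_i c x -> ~~ writes_i c y ->
  I 0%N (iset s x 0) ->
  (forall m s', agree (For x y c) s s' -> ivar s' x = m ->
     (m < ivar s y)%N -> I m s' ->
     runs c s' B (fun s'' => I m.+1 (iset s'' x m.+1))) ->
  runs (For x y c) s (ivar s y * (B + 12) + 9) (I (ivar s y)).
Proof.
move=> xy cx cy I0 h.
set N := ivar s y; rewrite /For; set W := While _ _.
have yx : (y == x) = false by rewrite eq_sym (negPf xy).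
(* Induction on the number [d] of remaining passes. A pass costs at most [B + 11], the failing test
   6, and the initial assignment with its sequencing 3. *)
suff H d s' : agree (For x y c) s s' -> (d <= N)%N -> ivar s' x = (N - d)%N ->
    I (N - d)%N s' -> runs W s' (d * (B + 12) + 6) (I N).
  have : runs W (iset s x 0) (N * (B + 12) + 6) (I N).
    apply: H; rewrite ?subnn //=; last by rewrite eqxx.
    by split=> //= z /norP[/negPf ->].
  move=> HW.
  apply: (@runs_weaken _ _ (2 + (N * (B + 12) + 6)).+1 _ (I N)) => //.
    by lia.
  by apply: runs_seq; apply: (@runs_iset x (IConst 0)).
elim: d s' => [|d IH] s' ag dN xv Iv.
all: have yv : ivar s' y = N by apply: (ag.1 y); rewrite /= yx (negPf cy).
  do 2 eexists; split; first apply: ExecWhileFalse => /=.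
  - by rewrite xv yv; lia.
  - by rewrite /=; lia.
  - by rewrite subn0 in Iv.
have [|t1 [s1 [e1 l1 q1]]] := h (N - d.+1)%N s' ag xv _ Iv.
  by rewrite -/N; lia.
have ag1 := exec_agree e1.
have x1 : ivar s1 x = (N - d.+1)%N by rewrite (ag1.1 x).
set s2 := iset s1 x (N - d)%N.
have [||||t2 [s3 [e3 l3 q3]]] := IH s2.
- split=> [z|a] /= nz.
    case/norP: (nz) => zx /norP[zc _].
    by rewrite (negPf zx) (ag1.1 z) // (ag.1 z).
  move=> j; rewrite (ag1.2 a) ?(ag.2 a) //.
  by move: nz; rewrite orbF.
- exact: ltnW.
- by rewrite /= eqxx.
- by rewrite /s2 -(subnSK dN).
do 2 eexists; split; first (apply: ExecWhileTrue; [| |exact: e3]).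
- by rewrite /= xv yv; lia.
- apply: ExecSeq; first exact: e1.
  have -> : s2 = iset s1 x (ieval s1 (IAdd (IVar x) (IConst 1))).
    by rewrite /s2 /= x1; congr iset; lia.
  exact: ExecISet.
- by rewrite /=; lia.
- exact: q3.
Qed.

Lemma ivar_iset s x m : ivar (iset s x m) x = m.
Proof. by rewrite /= eqxx. Qed.

(* Variables 0 to 3 and arrays 0 to 9 hold the input. The row vector
   <psi_0| mubar(x) of automaton [d] is kept in arrays [vre d] and [vim d], and
   [cvar d] holds the code of its current window. *)
Definition kvar (d : bool) : nat := if d then 2 else 0.
Definition nvar (d : bool) : nat := if d then 3 else 1.
Definition cvar (d : bool) : nat := if d then 5 else 4.
(** Row index, column index, word length, number of lengths to test, and the flag that stays 1 until
    a mismatch. *)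
Definition ivr : nat := 6.
Definition jvr : nat := 7.
Definition mvr : nat := 8.
Definition bvr : nat := 9.
Definition fvr : nat := 10.

Definition aacc (d : bool) : nat := if d then 5 else 0.
Definition psire (d : bool) : nat := if d then 6 else 1.
Definition psiim (d : bool) : nat := if d then 7 else 2.
Definition mure (d : bool) : nat := if d then 8 else 3.
Definition muim (d : bool) : nat := if d then 9 else 4.
Definition vre (d : bool) : nat := if d then 14 else 10.
Definition vim (d : bool) : nat := if d then 15 else 11.
(** Scratch space for the new row: every entry of the product needs the whole old row. *)
Definition wre (d : bool) : nat := if d then 16 else 12.
Definition wim (d : bool) : nat := if d then 17 else 13.
Definition darr : nat := 18.

(** * The decision program *)

Definition entry_addr (d : bool) : iexp :=
  IAdd (IMul (IAdd (IMul (IVar (cvar d)) (IVar (nvar d))) (IVar ivr))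
          (IVar (nvar d))) (IVar jvr).

(** The imaginary part is negated because the initial row is the conjugate of [psi0]; expressions
    have no unary minus. *)
Definition init_row (d : bool) : cmd :=
  For jvr (nvar d)
    (Seq (QSet (vre d) (IVar jvr) (QRead (psire d) (IVar jvr)))
         (QSet (vim d) (IVar jvr)
            (QSub (QConst 0) (QRead (psiim d) (IVar jvr))))).

Definition dot_column (d : bool) : cmd :=
  For ivr (nvar d)
    (Seq
      (QSet (wre d) (IVar jvr)
        (QAdd (QRead (wre d) (IVar jvr))
          (QSub
            (QMul (QRead (vre d) (IVar ivr)) (QRead (mure d) (entry_addr d)))
            (QMul (QRead (vim d) (IVar ivr)) (QRead (muim d) (entry_addr d))))))
      (QSet (wim d) (IVar jvr)
        (QAdd (QRead (wim d) (IVar jvr))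
          (QAdd
            (QMul (QRead (vre d) (IVar ivr)) (QRead (muim d) (entry_addr d)))
            (QMul (QRead (vim d) (IVar ivr)) (QRead (mure d) (entry_addr d))))))).

Definition mul_row (d : bool) : cmd :=
  For jvr (nvar d)
    (Seq (QSet (wre d) (IVar jvr) (QConst 0))
      (Seq (QSet (wim d) (IVar jvr) (QConst 0)) (dot_column d))).

Definition copy_row (d : bool) : cmd :=
  For jvr (nvar d)
    (Seq (QSet (vre d) (IVar jvr) (QRead (wre d) (IVar jvr)))
         (QSet (vim d) (IVar jvr) (QRead (wim d) (IVar jvr)))).

(** While the window is not full, one more letter enters and the code [c] becomes [2c + 1]; a full
    window no longer changes. *)
Definition next_code (d : bool) : cmd :=
  If (ILe (IAdd (IVar mvr) (IConst 1)) (IVar (kvar d)))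
    (ISet (cvar d) (IAdd (IAdd (IVar (cvar d)) (IVar (cvar d))) (IConst 1)))
    Skip.

(** The code is updated first because the step from length [m] to [m + 1] uses the window at
    position [m + 1]. *)
Definition advance_row (d : bool) : cmd :=
  Seq (next_code d) (Seq (mul_row d) (copy_row d)).

Definition add_prob (d : bool) (c : rat) : cmd :=
  For jvr (nvar d)
    (QSet darr (IConst 0)
      (QAdd (QRead darr (IConst 0))
        (QMul (QConst c)
          (QMul (QRead (aacc d) (IVar jvr))
            (QAdd
              (QMul (QRead (vre d) (IVar jvr)) (QRead (vre d) (IVar jvr)))
              (QMul (QRead (vim d) (IVar jvr)) (QRead (vim d) (IVar jvr)))))))).

(** The accumulated difference is tested for zero by two inequalities. The flag is only ever
    cleared, so a mismatch is never forgotten. *)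
Definition compare_probs : cmd :=
  Seq (QSet darr (IConst 0) (QConst 0))
    (Seq (add_prob false 1)
      (Seq (add_prob true (-1))
        (If (BAnd (QLe (QRead darr (IConst 0)) (QConst 0))
                  (QLe (QConst 0) (QRead darr (IConst 0))))
          Skip (ISet fvr (IConst 0))))).

(** Comparing before advancing makes pass [m] treat the word of length [m], starting with the empty
    one. The answer reaches variable 0 only at the end, since that variable holds [k1], which
    [next_code] reads. *)
Definition decide_equivalence : cmd :=
  Seq (ISet (cvar false) (IConst 0))
    (Seq (ISet (cvar true) (IConst 0))
      (Seq (init_row false)
        (Seq (init_row true)
          (Seq (ISet fvr (IConst 1))
            (Seq
              (ISet bvr
                (IAdd (IAdd (IVar (kvar false)) (IVar (kvar true)))
                  (IMul (IAdd (IVar (nvar false)) (IVar (nvar true)))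
                        (IAdd (IVar (nvar false)) (IVar (nvar true))))))
              (Seq
                (For mvr bvr
                  (Seq compare_probs
                    (Seq (advance_row false) (advance_row true))))
                (ISet 0 (IVar fvr)))))))).

(** * Correctness and cost of the subroutines *)

Definition arrE (d : bool) :
  ((vre d == vim d) = false) * ((vim d == vre d) = false) *
  ((psiim d == vre d) = false) * ((wre d == wim d) = false) *
  ((wim d == wre d) = false) * ((vim d == wre d) = false) *
  ((vre d == wre d) = false) * ((mure d == wre d) = false) *
  ((muim d == wre d) = false) * ((wim d == vre d) = false).
Proof. by case: d. Qed.

Lemma runs_init_row d s :
  runs (init_row d) s (ivar s (nvar d) * 40 + 9) (fun s' =>
    forall j, (j < ivar s (nvar d))%N ->
      qmem s' (vre d) j = qmem s (psire d) j /\
      qmem s' (vim d) j = - qmem s (psiim d) j).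
Proof.
pose I m s' := forall j, (j < m)%N ->
      qmem s' (vre d) j = qmem s (psire d) j /\
      qmem s' (vim d) j = - qmem s (psiim d) j.
(* The two assignments cost 4 and 6 and their sequencing 1; the stated bound is rounded up. *)
apply: (@runs_weaken _ _ (ivar s (nvar d) * (11 + 12) + 9) _
  (I (ivar s (nvar d)))) => //.
  lia.
apply: (@runs_for _ _ _ _ _ I); [by move: (d) => []..| |] => //.
move=> m s' ag jm mn IH.
have p1 : qmem s' (psire d) =1 qmem s (psire d) by apply: ag.2; move: (d) => [].
have p2 : qmem s' (psiim d) =1 qmem s (psiim d) by apply: ag.2; move: (d) => [].
apply: (@runs_seq _ _ _ 4 6); apply: (@runs_qset _ (IVar _)).
apply: (@runs_qset _ (IVar _) (QSub _ _)).
move=> j jm1; rewrite /= jm.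
rewrite !arrE /= !eqxx /=.
have [->|jm2] := eqVneq j m; first by rewrite p1 p2 sub0r.
by apply: IH; move: jm1; rewrite ltnS leq_eqVlt (negPf jm2).
Qed.

Definition mu_index (s : state) (d : bool) (c i j : nat) : nat :=
  ((c * ivar s (nvar d) + i) * ivar s (nvar d) + j)%N.

Definition dot_re (s : state) (d : bool) (c j m : nat) : rat :=
  \sum_(0 <= i < m)
    (qmem s (vre d) i * qmem s (mure d) (mu_index s d c i j) -
     qmem s (vim d) i * qmem s (muim d) (mu_index s d c i j)).

Definition dot_im (s : state) (d : bool) (c j m : nat) : rat :=
  \sum_(0 <= i < m)
    (qmem s (vre d) i * qmem s (muim d) (mu_index s d c i j) +
     qmem s (vim d) i * qmem s (mure d) (mu_index s d c i j)).

(** The last clause is needed for [runs_mul_row]: the frame condition speaks of whole arrays only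
    and cannot protect the entries already computed. *)
Lemma runs_dot_column d s :
  runs (dot_column d) s (ivar s (nvar d) * 100 + 9) (fun s' =>
    let c := ivar s (cvar d) in let j := ivar s jvr in
    let n := ivar s (nvar d) in
    [/\ qmem s' (wre d) j = qmem s (wre d) j + dot_re s d c j n,
        qmem s' (wim d) j = qmem s (wim d) j + dot_im s d c j n &
        forall l, l != j -> qmem s' (wre d) l = qmem s (wre d) l /\
                            qmem s' (wim d) l = qmem s (wim d) l]).
Proof.
set c := ivar s (cvar d); set n := ivar s (nvar d); set j := ivar s jvr => /=.
pose I m s' :=
    [/\ qmem s' (wre d) j = qmem s (wre d) j + dot_re s d c j m,
        qmem s' (wim d) j = qmem s (wim d) j + dot_im s d c j m &
        forall l, l != j -> qmem s' (wre d) l = qmem s (wre d) l /\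
                            qmem s' (wim d) l = qmem s (wim d) l].
apply: (@runs_weaken _ _ (n * (65 + 12) + 9) _ (I n)) => //; first lia.
apply: (@runs_for _ _ _ _ _ I); [by move: (d) => []..| |].
  by split=> //; rewrite /dot_re /dot_im big_geq // addr0.
move=> m s' ag im mn [IH1 IH2 IH3].
have p1 : qmem s' (vre d) =1 qmem s (vre d) by apply: ag.2; move: (d) => [].
have p2 : qmem s' (vim d) =1 qmem s (vim d) by apply: ag.2; move: (d) => [].
have p3 : qmem s' (mure d) =1 qmem s (mure d) by apply: ag.2; move: (d) => [].
have p4 : qmem s' (muim d) =1 qmem s (muim d) by apply: ag.2; move: (d) => [].
have p5 : ivar s' (cvar d) = c by apply: ag.1; move: (d) => [].
have p6 : ivar s' (nvar d) = n by apply: ag.1; move: (d) => [].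
have p7 : ivar s' jvr = j by apply: ag.1; move: (d) => [].
apply: (@runs_seq _ _ _ 32 32); apply: (@runs_qset _ (IVar _)).
apply: (@runs_qset _ (IVar _) (QAdd _ _)).
split=> [||l lj].
- rewrite /= !arrE /= p5 p6 p7 im !eqxx /= IH1 p1 p2 p3 p4.
  by rewrite /dot_re big_nat_recr //= -!addrA.
- rewrite /= !arrE /= p5 p6 p7 im !eqxx /= IH2 p1 p2 p3 p4.
  by rewrite /dot_im big_nat_recr //= -!addrA.
- by rewrite /= p7 (negPf lj) !andbF; apply: IH3.
Qed.

Lemma runs_mul_row d s :
  runs (mul_row d) s (ivar s (nvar d) * (ivar s (nvar d) * 100 + 29) + 9)
   (fun s' => forall j, (j < ivar s (nvar d))%N ->
    qmem s' (wre d) j = dot_re s d (ivar s (cvar d)) j (ivar s (nvar d)) /\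
    qmem s' (wim d) j = dot_im s d (ivar s (cvar d)) j (ivar s (nvar d))).
Proof.
set c := ivar s (cvar d); set n := ivar s (nvar d).
pose I m s' := forall j, (j < m)%N ->
    qmem s' (wre d) j = dot_re s d c j n /\
    qmem s' (wim d) j = dot_im s d c j n.
apply: (@runs_weaken _ _ (n * ((3 + (3 + (n * 100 + 9)).+1).+1 + 12) + 9) _
  (I n)) => //; first lia.
apply: (@runs_for _ _ _ _ _ I); [by move: (d) => []..| by [] |].
move=> m s' ag jm mn IH.
have p1 : qmem s' (vre d) =1 qmem s (vre d) by apply: ag.2; move: (d) => [].
have p2 : qmem s' (vim d) =1 qmem s (vim d) by apply: ag.2; move: (d) => [].
have p3 : qmem s' (mure d) =1 qmem s (mure d) by apply: ag.2; move: (d) => [].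
have p4 : qmem s' (muim d) =1 qmem s (muim d) by apply: ag.2; move: (d) => [].
have p5 : ivar s' (cvar d) = c by apply: ag.1; move: (d) => [].
have p6 : ivar s' (nvar d) = n by apply: ag.1; move: (d) => [].
apply: runs_seq; apply: (@runs_qset _ (IVar _) (QConst _)).
apply: runs_seq; apply: (@runs_qset _ (IVar _) (QConst _)).
set s2 := qset _ _ _ _.
have e6 : ivar s2 (nvar d) = n by [].
have e5 : ivar s2 (cvar d) = c by [].
have e7 : ivar s2 jvr = m by [].
have [r1 r2] : dot_re s2 d c m n = dot_re s d c m n /\
   dot_im s2 d c m n = dot_im s d c m n.
  split; apply: eq_bigr => i _; rewrite /= /mu_index e6 -/n.
    by rewrite -p1 -p2 -p3 -p4; move: (d) => [].
  by rewrite -p1 -p2 -p3 -p4; move: (d) => [].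
move: (runs_dot_column d s2); rewrite e5 e6 e7.
apply: runs_weaken => // s3 ag3 /= [g1 g2 g3] j jm1.
rewrite r1 r2 in g1 g2.
have [->|jm2] := eqVneq j m.
  rewrite g1 g2 /s2 /= !arrE /= jm !eqxx /=.
  by rewrite !add0r.
have [-> ->] := g3 j jm2.
rewrite /s2 /= jm (negPf jm2) !andbF.
by apply: IH; move: jm1; rewrite ltnS leq_eqVlt (negPf jm2).
Qed.

Lemma runs_copy_row d s :
  runs (copy_row d) s (ivar s (nvar d) * 30 + 9) (fun s' =>
    forall j, (j < ivar s (nvar d))%N ->
      qmem s' (vre d) j = qmem s (wre d) j /\
      qmem s' (vim d) j = qmem s (wim d) j).
Proof.
pose I m s' := forall j, (j < m)%N ->
      qmem s' (vre d) j = qmem s (wre d) j /\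
      qmem s' (vim d) j = qmem s (wim d) j.
apply: (@runs_weaken _ _ (ivar s (nvar d) * (9 + 12) + 9) _
  (I (ivar s (nvar d)))) => //.
  lia.
apply: (@runs_for _ _ _ _ _ I); [by move: (d) => []..| |] => //.
move=> m s' ag jm mn IH.
have p1 : qmem s' (wre d) =1 qmem s (wre d) by apply: ag.2; move: (d) => [].
have p2 : qmem s' (wim d) =1 qmem s (wim d) by apply: ag.2; move: (d) => [].
apply: (@runs_seq _ _ _ 4 4); apply: (@runs_qset _ (IVar _)).
apply: (@runs_qset _ (IVar _) (QRead _ _)).
move=> j jm1; rewrite /= jm.
rewrite !arrE /= !eqxx /=.
have [->|jm2] := eqVneq j m; first by rewrite p1 p2.
by apply: IH; move: jm1; rewrite ltnS leq_eqVlt (negPf jm2).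
Qed.

Definition prob_term (s : state) (d : bool) (j : nat) : rat :=
  qmem s (aacc d) j *
    (qmem s (vre d) j * qmem s (vre d) j + qmem s (vim d) j * qmem s (vim d) j).

Lemma runs_add_prob d c s :
  runs (add_prob d c) s (ivar s (nvar d) * 40 + 9) (fun s' =>
    qmem s' darr 0%N = qmem s darr 0%N +
      c * \sum_(0 <= j < ivar s (nvar d)) prob_term s d j).
Proof.
pose I m s' := qmem s' darr 0%N = qmem s darr 0%N +
      c * \sum_(0 <= j < m) prob_term s d j.
apply: (@runs_weaken _ _ (ivar s (nvar d) * (21 + 12) + 9) _
  (I (ivar s (nvar d)))) => //.
  lia.
apply: (@runs_for _ _ _ _ _ I); [by move: (d) => []..| |].
  by rewrite /I big_geq // mulr0 addr0.
move=> m s' ag jm mn IH.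
have p1 : qmem s' (vre d) =1 qmem s (vre d) by apply: ag.2; move: (d) => [].
have p2 : qmem s' (vim d) =1 qmem s (vim d) by apply: ag.2; move: (d) => [].
have p3 : qmem s' (aacc d) =1 qmem s (aacc d) by apply: ag.2; move: (d) => [].
apply: (@runs_qset _ (IConst _)).
by rewrite /I /= jm IH p1 p2 p3 big_nat_recr //= [in RHS]mulrDr addrA.
Qed.

Lemma runs_compare_probs s :
  runs compare_probs s (ivar s (nvar false) * 40 + ivar s (nvar true) * 40 + 50)
    (fun s' => ivar s' fvr =
       if \sum_(0 <= j < ivar s (nvar false)) prob_term s false j ==
          \sum_(0 <= j < ivar s (nvar true)) prob_term s true j
       then ivar s fvr else 0%N).
Proof.
set n1 := ivar s (nvar false); set n2 := ivar s (nvar true).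
set x1 := \sum_(0 <= j < n1) _; set x2 := \sum_(0 <= j < n2) _.
pose Q s' := ivar s' fvr = if x1 == x2 then ivar s fvr else 0%N.
apply: (@runs_weaken _ _
  (3 + (n1 * 40 + 9 + (n2 * 40 + 9 + (9 + 2).+1).+1).+1).+1 _ Q) => //;
  first lia.
apply: runs_seq; apply: (@runs_qset _ (IConst _) (QConst _)).
  apply: runs_seq; apply: runs_weaken (runs_add_prob false 1 _) => //.
  move=> s1 ag1 h1.
  apply: runs_seq; apply: runs_weaken (runs_add_prob true (-1) _) => //.
    by rewrite (ag1.1 (nvar true)).
  move=> s2 ag2 h2.
  have {}h2 : qmem s2 darr 0%N = x1 - x2.
    rewrite h2 h1 /= add0r mul1r mulN1r; congr (_ - _).
    rewrite (ag1.1 (nvar true)) //; apply: eq_bigr => j _.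
    by rewrite /prob_term !ag1.2.
  have f2 : ivar s2 fvr = ivar s fvr by rewrite (ag2.1 fvr) // (ag1.1 fvr).
  apply: (@runs_if _ _ _ _ 2) => /= [|/negPf] hb.
    apply: (@runs_weaken _ _ 1 _ Q) => //.
    apply: runs_skip; rewrite /Q f2 ifT // -subr_eq0 -h2.
    by move: hb; rewrite eq_le.
  apply: runs_iset; rewrite /Q /= ifF // -subr_eq0 -h2.
  by rewrite eq_le hb.
Qed.

(** * From rational memory cells to complex amplitudes *)

Lemma cplx_of_ratM (R : realType) (a b c d : rat) :
  cplx_of_rat R a b * cplx_of_rat R c d =
  cplx_of_rat R (a * c - b * d) (a * d + b * c).
Proof.
rewrite /cplx_of_rat rmorphB rmorphD !rmorphM /=.
by apply/eqP; rewrite eq_complex /= !eqxx.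
Qed.

Lemma cplx_of_rat_sum (R : realType) (n : nat) (f g : nat -> rat) :
  \sum_(i < n) cplx_of_rat R (f i) (g i) =
  cplx_of_rat R (\sum_(0 <= i < n) f i) (\sum_(0 <= i < n) g i).
Proof.
rewrite !big_mkord /cplx_of_rat !rmorph_sum /=.
elim/big_rec3: _ => [|i x y z _ ->]; first by [].
by apply/eqP; rewrite eq_complex /= !eqxx.
Qed.

Lemma cplx_of_rat_conj (R : realType) (a b : rat) :
  (cplx_of_rat R a b)^* = cplx_of_rat R a (- b).
Proof. by rewrite /cplx_of_rat rmorphN. Qed.

Lemma sqr_normc_cplx_of_rat (R : realType) (a b : rat) :
  Normc.normc (cplx_of_rat R a b) ^+ 2 = ratr (a * a + b * b).
Proof.
by rewrite /= sqr_sqrtr ?addr_ge0 ?sqr_ge0 // rmorphD !rmorphM !expr2.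
Qed.

Section Automaton.

Variables (R : realType) (k n : nat) (A : qfa R unit k n).

(** An empty sum of squares is not 1. Positivity lets powers of [n] absorb constants in the final
    time bound. *)
Lemma qfa_size_gt0 : (0 < n)%N.
Proof.
rewrite lt0n; apply/eqP => n0; have := psi0_unit A.
rewrite /sqnorm big1 => [/eqP|j]; first by rewrite eq_sym oner_eq0.
by exfalso; case: j => j; rewrite n0.
Qed.

(** The stored code is that of the window last used; for [m = 0] it is the all-blank window, of code
    0. *)
Definition encodes (s : state) (d : bool) (m : nat) : Prop :=
  [/\ stores s d A, ivar s (cvar d) = wcode (uwin k m) &
      forall j : 'I_n,
        urow A m 0 j = cplx_of_rat R (qmem s (vre d) j) (qmem s (vim d) j)].

Lemma storesE s (d : bool) :
  stores s d A <->
  [/\ ivar s (kvar d) = k, ivar s (nvar d) = n,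
      forall q : 'I_n, qmem s (aacc d) q = (q \in acc A)%:R,
      forall q : 'I_n,
        psi0 A q 0 = cplx_of_rat R (qmem s (psire d) q) (qmem s (psiim d) q) &
      forall w (i j : 'I_n),
        mu A w i j = cplx_of_rat R (qmem s (mure d) (mu_addr w i j))
                                   (qmem s (muim d) (mu_addr w i j))].
Proof. by case: d. Qed.

Definition clobbers_input (c : cmd) (d : bool) : bool :=
  has (writes_i c) [:: kvar d; nvar d] ||
  has (writes_q c) [:: aacc d; psire d; psiim d; mure d; muim d].

Definition clobbers (c : cmd) (d : bool) : bool :=
  [|| clobbers_input c d, writes_i c (cvar d) |
      has (writes_q c) [:: vre d; vim d]].

Lemma stores_agree c s s' (d : bool) :
  agree c s s' -> ~~ clobbers_input c d -> stores s d A -> stores s' d A.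
Proof.
move=> [hi hq]; rewrite /clobbers_input /= !negb_or.
move=> /andP[/and3P[h1 h2 _] /and5P[h3 h4 h5 h6 /andP[h7 _]]].
rewrite !storesE => -[s1 s2 s3 s4 s5].
split; rewrite ?hi //.
- by move=> q; rewrite hq.
- by move=> q; rewrite !hq.
- by move=> w i j; rewrite !hq.
Qed.

Lemma encodes_agree c s s' (d : bool) m :
  agree c s s' -> ~~ clobbers c d -> encodes s d m -> encodes s' d m.
Proof.
move=> ag; rewrite /clobbers => /norP[nin /norP[nc]] /=.
rewrite !negb_or => /and3P[n1 n2 _] [h1 h2 h3].
split; first exact: stores_agree ag nin h1.
  by rewrite ag.1.
by move=> j; rewrite !ag.2.
Qed.

Lemma runs_next_code s d m :
  ivar s mvr = m -> encodes s d m ->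
  runs (next_code d) s 12 (fun s' => ivar s' (cvar d) = wcode (uwin k m.+1)).
Proof.
move=> sm [/storesE[hk _ _ _ _] hc _].
apply: (@runs_if _ _ _ _ 6) => /= h.
  apply: (@runs_iset _ (IAdd _ _)); rewrite ivar_iset /= hc !wcode_uwin.
  move: h; rewrite hk sm addn1 => h.
  rewrite (minn_idPl h) (minn_idPl (ltnW h)) expnS.
  (* Positivity of [2 ^ m] matters because the predecessor is truncated. *)
  by have := expn_gt0 2 m; lia.
apply: (@runs_weaken _ _ 1 _
  (fun s' => ivar s' (cvar d) = wcode (uwin k m.+1))) => //.
apply: runs_skip; rewrite hc !wcode_uwin; congr (_ ^ _).-1.
by move: h; rewrite hk sm; lia.
Qed.

Lemma runs_advance_row s d m :
  ivar s mvr = m -> encodes s d m ->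
  runs (advance_row d) s (n * n * 100 + n * 59 + 32)
    (fun s' => encodes s' d m.+1).
Proof.
move=> sm en; have [st hc hv] := en; have /storesE[hk hn ha hp hm] := st.
apply: (@runs_weaken _ _ (12 + ((n * (n * 100 + 29) + 9) + (n * 30 + 9)).+1).+1 _
  (fun s' => ivar s' (cvar d) = wcode (uwin k m.+1) /\
    forall j : 'I_n,
      urow A m.+1 0 j = cplx_of_rat R (qmem s' (vre d) j) (qmem s' (vim d) j))).
- lia.
- move=> s' ag [h1 h2]; split=> //.
  by apply: stores_agree ag _ st; move: (d) => [].
apply: runs_seq; apply: runs_weaken (runs_next_code sm en) => // s1 ag1 h1.
have n1 : ivar s1 (nvar d) = n by rewrite (ag1.1 (nvar d)) //; move: (d) => [].
apply: runs_seq; apply: runs_weaken (runs_mul_row d s1); rewrite n1 //.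
move=> s2 ag2 h2.
have n2 : ivar s2 (nvar d) = n by rewrite (ag2.1 (nvar d)) //; move: (d) => [].
apply: runs_weaken (runs_copy_row d s2); rewrite n2 //.
move=> s3 ag3 h3; split.
  rewrite (ag3.1 (cvar d)); last by move: (d) => [].
  by rewrite (ag2.1 (cvar d)) ?h1 //; move: (d) => [].
move=> j; have [-> ->] := h3 j (ltn_ord j); have [-> ->] := h2 j (ltn_ord j).
rewrite /dot_re /dot_im -cplx_of_rat_sum urowS mxE; apply: eq_bigr => i _.
rewrite hv hm cplx_of_ratM /mu_addr /mu_index n1 h1.
by rewrite !ag1.2 //; move: (d) => [].
Qed.

Lemma runs_init_encodes s (d : bool) :
  stores s d A -> ivar s (cvar d) = 0%N ->
  runs (init_row d) s (n * 40 + 9) (fun s' => encodes s' d 0).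
Proof.
move=> st c0; have /storesE[hk hn ha hp hm] := st.
have := runs_init_row d s; rewrite hn; apply: runs_weaken => // s' ag h.
split.
- by apply: stores_agree ag _ st; move: (d) => [].
- rewrite (ag.1 (cvar d)); last by move: (d) => [].
  by rewrite c0 wcode_uwin min0n.
move=> j; have [-> ->] := h j (ltn_ord j).
by rewrite urow0 !mxE hp -cplx_of_rat_conj.
Qed.

Lemma accprob_encodes s (d : bool) m :
  encodes s d m ->
  accprob A (nseq m tt) =
  ratr (\sum_(0 <= j < ivar s (nvar d)) prob_term s d j).
Proof.
move=> [/storesE[hk hn ha hp hm] hc hv].
rewrite hn big_mkord rmorph_sum accprob_nseq /=; apply: eq_bigr => j _.
by rewrite hv sqr_normc_cplx_of_rat /prob_term rmorphM ha /= ratr_nat.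
Qed.

End Automaton.

(** * Correctness and running time of the whole program *)

Section Decision.

Variables (R : realType) (k1 k2 n1 n2 : nat).
Variables (A1 : qfa R unit k1 n1) (A2 : qfa R unit k2 n2).

Definition loop_invariant (m : nat) (s : state) : Prop :=
  [/\ encodes A1 s false m, encodes A2 s true m &
      ivar s fvr != 0%N <->
      forall i, (i < m)%N -> accprob A1 (nseq i tt) = accprob A2 (nseq i tt)].

(** Here 99 = 40 + 59 adds the linear costs of comparing and advancing, and 116 = 50 + 32 + 32 + 2
    the constant ones with two sequencings. *)
Definition pass_time : nat :=
  100 * (n1 * n1 + n2 * n2) + 99 * (n1 + n2) + 116.

Lemma runs_pass s m :
  ivar s mvr = m -> loop_invariant m s ->
  runs (Seq compare_probs (Seq (advance_row false) (advance_row true))) s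
    pass_time
    (fun s' => loop_invariant m.+1 (iset s' mvr m.+1)).
Proof.
move=> sm [e1 e2 hf].
have [/storesE[_ sn1 _ _ _] _ _] := e1.
have [/storesE[_ sn2 _ _ _] _ _] := e2.
pose Q s' := [/\ encodes A1 s' false m.+1, encodes A2 s' true m.+1 &
      ivar s' fvr != 0%N <->
      forall i, (i < m.+1)%N -> accprob A1 (nseq i tt) = accprob A2 (nseq i tt)].
apply: (@runs_weaken _ _ ((n1 * 40 + n2 * 40 + 50) +
   (n1 * n1 * 100 + n1 * 59 + 32 + (n2 * n2 * 100 + n2 * 59 + 32)).+1).+1 _ Q).
- rewrite /pass_time; lia.
- by move=> s' _ [q1 q2 q3]; split.
apply: runs_seq; have := runs_compare_probs s; rewrite sn1 sn2.
apply: runs_weaken => // s1 ag1 h1.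
have e11 : encodes A1 s1 false m by apply: encodes_agree ag1 _ e1.
have e21 : encodes A2 s1 true m by apply: encodes_agree ag1 _ e2.
have m1 : ivar s1 mvr = m by rewrite (ag1.1 mvr).
apply: runs_seq; apply: runs_weaken (runs_advance_row m1 e11) => // s2 ag2 h2.
have e22 : encodes A2 s2 true m by apply: encodes_agree ag2 _ e21.
have m2 : ivar s2 mvr = m by rewrite (ag2.1 mvr).
apply: runs_weaken (runs_advance_row m2 e22) => // s3 ag3 h3.
split=> //; first by apply: encodes_agree ag3 _ h2.
rewrite (ag3.1 fvr) // (ag2.1 fvr) // h1.
have E : (\sum_(0 <= j < n1) prob_term s false j ==
          \sum_(0 <= j < n2) prob_term s true j) <->
    accprob A1 (nseq m tt) = accprob A2 (nseq m tt).
  rewrite (accprob_encodes e1) (accprob_encodes e2) sn1 sn2.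
  by split=> [/eqP->//|/fmorph_inj/eqP].
(* If the probabilities at [m] agree, the flag is kept and the claim extends to [m]; otherwise the
   flag is 0 and [m] refutes the claim. *)
case: ifP => [/E Em|/negP nE].
  split=> [/hf h i|h].
    by rewrite ltnS leq_eqVlt => /orP[/eqP->//|/h].
  by apply/hf => i im; apply: h; apply: ltnW.
by split=> // h; case: nE; apply/E; apply: h.
Qed.

Lemma runs_decide_equivalence s :
  input_state s A1 A2 ->
  runs decide_equivalence s
    ((k1 + k2 + (n1 + n2) * (n1 + n2)) * (pass_time + 12) +
      40 * (n1 + n2) + 60)
    (fun s' => answers_yes s' <-> equivalent A1 A2).
Proof.
move=> [st1 st2].
set N := (k1 + k2 + (n1 + n2) * (n1 + n2))%N.
pose Q s' := answers_yes s' <-> equivalent A1 A2.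
apply: (@runs_weaken _ _ (2 + (2 + (n1 * 40 + 9 + (n2 * 40 + 9 +
  (2 + (12 + (N * (pass_time + 12) + 9 + 2).+1).+1).+1).+1).+1).+1).+1 _ Q) => //.
  lia.
apply: runs_seq; apply: (@runs_iset _ (IConst 0)).
apply: runs_seq; apply: (@runs_iset _ (IConst 0)).
set s1 := iset _ _ _.
have st11 : stores s1 false A1 by exact: st1.
have st21 : stores s1 true A2 by exact: st2.
apply: runs_seq; apply: runs_weaken (runs_init_encodes st11 _) => //.
move=> s2 ag2 e12.
have st22 : stores s2 true A2 by apply: stores_agree ag2 _ st21.
have c22 : ivar s2 (cvar true) = 0%N by rewrite (ag2.1 (cvar true)).
apply: runs_seq; apply: runs_weaken (runs_init_encodes st22 c22) => //.
move=> s3 ag3 e23.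
have e13 : encodes A1 s3 false 0 by apply: encodes_agree ag3 _ e12.
apply: runs_seq; apply: (@runs_iset _ (IConst 1)); set s4 := iset _ _ _.
have ag4 := exec_agree (ExecISet s3 fvr (IConst 1)).
have e14 : encodes A1 s4 false 0 by apply: encodes_agree ag4 _ e13.
have e24 : encodes A2 s4 true 0 by apply: encodes_agree ag4 _ e23.
have f4 : ivar s4 fvr = 1%N by [].
clearbody s4.
apply: runs_seq; apply: (@runs_iset _ (IAdd _ _)).
set bexp := IAdd (IAdd _ _) _; set s5 := iset s4 _ _.
have ag5 := exec_agree (ExecISet s4 bvr bexp).
have e15 : encodes A1 s5 false 0 by apply: encodes_agree ag5 _ e14.
have e25 : encodes A2 s5 true 0 by apply: encodes_agree ag5 _ e24.
have b5 : ivar s5 bvr = N.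
  have [/storesE[kk1 nn1 _ _ _] _ _] := e14.
  have [/storesE[kk2 nn2 _ _ _] _ _] := e24.
  by rewrite ivar_iset /bexp /= kk1 nn1 kk2 nn2.
apply: runs_seq.
apply: (@runs_weaken _ _ (N * (pass_time + 12) + 9) _ (loop_invariant N)) => //.
  (* After [N] passes the flag records agreement on all lengths below [N], which
     [equivalent_bounded] turns into equivalence. *)
  move=> s6 _ [_ _ hf]; apply: runs_iset.
  rewrite /Q /answers_yes ivar_iset; split=> [/hf|h].
    exact: equivalent_bounded.
  by apply/hf.
rewrite -b5; apply: (@runs_for _ _ _ _ _ loop_invariant) => //.
  by split=> //; rewrite /= f4.
by move=> m s' _ sm _ inv; apply: runs_pass.
Qed.

End Decision.

Theorem mainTheorem4 (R : realType) :
  exists (algo : cmd) (C : nat),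
  forall (k1 k2 n1 n2 : nat)
         (A1 : qfa R unit k1 n1) (A2 : qfa R unit k2 n2),
    (1 <= k1)%N -> (1 <= k2)%N -> rational_data A1 -> rational_data A2 ->
  forall s : state, input_state s A1 A2 ->
  let n := (n1 + n2)%N in
  let k := maxn k1 k2 in
  exists (t : nat) (s' : state),
    [/\ exec algo s t s',
        (t <= C * (n ^ 12 + k ^ 2 * n ^ 4 + k * n ^ 8))%N &
        answers_yes s' <-> equivalent A1 A2].
Proof.
exists decide_equivalence, 2000%N => k1 k2 n1 n2 A1 A2 _ _ _ _ s st n k.
have [t [s' [e l q]]] := runs_decide_equivalence st; exists t, s'; split=> //.
apply: leq_trans l _.
have n_gt0 : (0 < n)%N by rewrite addn_gt0 (qfa_size_gt0 A1).
have kk : (k1 + k2 <= 2 * k)%N by rewrite /k; lia.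
(* The constant is 327 = 100 + 99 + 116 + 12, each term being bounded by a multiple of [n ^ 2]. *)
have pass : (pass_time n1 n2 + 12 <= 327 * n ^ 2)%N.
  have nn : (n <= n ^ 2)%N by rewrite -{1}[n]expn1 leq_pexp2l.
  have : (n1 * n1 + n2 * n2 <= n ^ 2)%N by rewrite /n; nia.
  by rewrite /pass_time -/n; lia.
have e1 : (n <= n ^ 12)%N by rewrite -{1}[n]expn1 leq_pexp2l.
have e2 : (n * n * n ^ 2 <= n ^ 12)%N by rewrite mulnn -expnD leq_pexp2l.
have e3 : (k * n ^ 2 <= k * n ^ 8)%N by rewrite leq_mul2l leq_pexp2l ?orbT.
(* Expanding, [k * n ^ 2] is absorbed by [k * n ^ 8], and [n ^ 4], [n] and 1 by [n ^ 12]; the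
   coefficients 654 and 327 + 40 + 60 stay below 2000. *)
apply: (@leq_trans ((2 * k + n * n) * (327 * n ^ 2) + 40 * n + 60)).
  by rewrite !leq_add2r leq_mul // leq_add2r.
move: e1 e2 e3 n_gt0; move: (n ^ 12)%N (n ^ 8)%N (n ^ 2)%N => x y z.
nia.
Qed.
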